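(* Let $\mathcal{M}=(M,G,\triangleright)$ be a right amenable left homogeneous space with finite stabilisers, and let $\Delta\colon Q^M\to Q^M$ be the global transition function of a cellular automaton over $\mathcal{M}$ with finite set of states $Q$ and finite neighbourhood. Then $\Delta$ is surjective if and only if $\Delta$ is pre-injective.
   Context: A left homogeneous space $\mathcal{M}=(M,G,\triangleright)$ is a nonempty set $M$ with a transitive left action $\triangleright$ of a group $G$. A coordinate system for $\mathcal{M}$ is a tuple $\mathcal{K}=(m_0,(g_{m_0,m})_{m\in M})$ with $m_0\in M$ and $g_{m_0,m}\in G$ satisfying $g_{m_0,m}\triangleright m_0=m$; then $\mathcal{R}=(\mathcal{M},\mathcal{K})$ is a cell space. Let $G_0$ be the stabiliser of $m_0$ and $G/G_0$ the set of left cosets; $G$ acts on $G/G_0$ by $g\cdot hG_0=ghG_0$. The right semi-action is $\triangleleft\colon M\times G/G_0\to M$, $m\triangleleft gG_0=g_{m_0,m}g\triangleright m_0$. ''Finite stabilisers'' means $G_0$ is finite. $\mathcal{M}$ is right amenable if there is a coordinate system $\mathcal{K}$ and a finitely additive probability measure $\mu$ on the power set of $M$ such that for every $\mathfrak{g}\in G/G_0$ and every $A\subseteq M$ on which $m\mapsto m\triangleleft\mathfrak{g}$ is injective, $\mu(\{a\triangleleft\mathfrak{g}:a\in A\})=\mu(A)$. A cellular automaton over the cell space $\mathcal{R}$ is a quadruple $(\mathcal{R},Q,N,\delta)$ with $Q$ a set, $N\subseteq G/G_0$ with $G_0\cdot N\subseteq N$, and $\delta\colon Q^N\to Q$ satisfying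 $\delta(g_0\bullet\ell)=\delta(\ell)$ for all $g_0\in G_0$, $\ell\in Q^N$, where $(g_0\bullet\ell)(n)=\ell(g_0^{-1}\cdot n)$; its global transition function is $\Delta\colon Q^M\to Q^M$, $\Delta(c)(m)=\delta(n\mapsto c(m\triangleleft n))$. A cellular automaton over $\mathcal{M}$ is one over $(\mathcal{M},\mathcal{K})$ for some coordinate system $\mathcal{K}$ (by earlier work of the author, the class of global transition functions of cellular automata over $\mathcal{M}$ with finite $Q$ and finite $N$ does not depend on the choice of $\mathcal{K}$). For $c,c'\in Q^M$ let $\mathrm{diff}(c,c')=\{m\in M: c(m)\neq c'(m)\}$. The map $\Delta$ is pre-injective if for all $c,c'\in Q^M$ with $\mathrm{diff}(c,c')$ finite and $\Delta(c)=\Delta(c')$ we have $c=c'$. *)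

(* Defs.v *)
From Stdlib Require Import Reals List ClassicalEpsilon.
Set Implicit Arguments.
Open Scope R_scope.

Record Group := {
  gcar :> Type;
  gmul : gcar -> gcar -> gcar;
  ginv : gcar -> gcar;
  gone : gcar;
  gmul_assoc : forall x y z, gmul (gmul x y) z = gmul x (gmul y z);
  gmul_1l : forall x, gmul gone x = x;
  gmul_Vl : forall x, gmul (ginv x) x = gone
}.

Record LHS (G : Group) := {
  mcar :> Type;
  act : G -> mcar -> mcar;
  act_one : forall m, act (gone G) m = m;
  act_mul : forall g h m, act (gmul G g h) m = act g (act h m);
  lhs_nonempty : inhabited mcar;
  lhs_transitive : forall m m', exists g, act g m = m'
}.

Record coord (G : Group) (X : LHS G) := {
  m0 : X;
  gsel : X -> G;
  gsel_spec : forall m, act X (gsel m) m0 = m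
}.

Definition finite_set (T : Type) (P : T -> Prop) : Prop :=
  exists l : list T, forall x, P x -> In x l.
Definition finite_type (T : Type) : Prop :=
  exists l : list T, forall x : T, In x l.

Section Cosets.
Variables (G : Group) (X : LHS G).

Definition stab (m : X) (g : G) : Prop := act X g m = m.

Definition finite_stabilisers : Prop := forall m : X, finite_set (stab m).

Variable K : coord X.

Definition is_coset (C : G -> Prop) : Prop :=
  exists g : G, forall h, C h <-> exists g0, stab (m0 K) g0 /\ h = gmul G g g0.

Definition coset : Type := { C : G -> Prop | is_coset C }.

Definition cos_of (x : G) : coset :=
  exist is_coset (fun h => exists g0, stab (m0 K) g0 /\ h = gmul G x g0)
    (ex_intro _ x (fun h => conj (fun H => H) (fun H => H))).

Definition rep (C : coset) : G :=
  proj1_sig (constructive_indefinite_description _ (proj2_sig C)).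

Definition cact (g : G) (C : coset) : coset := cos_of (gmul G g (rep C)).

Definition rsemi (m : X) (C : coset) : X := act X (gmul G (gsel K m) (rep C)) (m0 K).

(** Cellular automata over (X, K) with state set Q, neighbourhood N and local
    rule delta.  A map Q^N -> Q is represented by a map (coset -> Q) -> Q that
    only depends on the values on N. *)
Definition is_CA (Q : Type) (N : coset -> Prop) (delta : (coset -> Q) -> Q) : Prop :=
  (forall l l' : coset -> Q, (forall n, N n -> l n = l' n) -> delta l = delta l') /\
  (forall g0, stab (m0 K) g0 -> forall n, N n -> N (cact g0 n)) /\
  (forall g0, stab (m0 K) g0 -> forall l : coset -> Q,
      delta (fun n => l (cact (ginv G g0) n)) = delta l).

Definition global (Q : Type) (delta : (coset -> Q) -> Q) (c : X -> Q) : X -> Q :=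
  fun m => delta (fun n => c (rsemi m n)).

End Cosets.

Definition right_amenable (G : Group) (X : LHS G) : Prop :=
  exists (K : coord X) (mu : (X -> Prop) -> R),
    (forall A, 0 <= mu A) /\
    mu (fun _ => True) = 1 /\
    (forall A B : X -> Prop, (forall x, A x -> B x -> False) ->
        mu (fun x => A x \/ B x) = mu A + mu B) /\
    (forall (g : coset K) (A : X -> Prop),
        (forall a b, A a -> A b -> rsemi a g = rsemi b g -> a = b) ->
        mu (fun y => exists a, A a /\ y = rsemi a g) = mu A).

Definition surjective_map (T U : Type) (f : T -> U) : Prop :=
  forall u, exists t, f t = u.

Definition pre_injective (M Q : Type) (D : (M -> Q) -> (M -> Q)) : Prop :=
  forall c c' : M -> Q, finite_set (fun m => c m <> c' m) -> D c = D c' -> c = c'.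

(* Main.v *)
Require Import Defs.
From Stdlib Require Import Reals List ClassicalEpsilon.
From Stdlib Require Import Classical FunctionalExtensionality PropExtensionality.
From Stdlib Require Import Arith Lia Lra.
From mathcomp Require classical_sets.

(** Everything is phrased through [G]-invariant relations [R] on [X] with finite sections; these do not refer to a coordinate system, and finite stabilisers make them stable under converse.

    If no finite [F] had [|R(F)|] close to [|F|], then an iterate of [R] would at least double every finite set, and Hall's theorem would give an injection of two disjoint copies of [X] into [X] moving points along that iterate, which the invariant mean forbids. So Foelner sets exist.

    Inside a Foelner set [F], a greedy choice gives a positive proportion of points carrying disjoint translates of a fixed pattern. The number of patterns on [R(F)] avoiding the pattern at all these translates is then less than [|Q|^|F|]. If the map is not pre-injective, one of two mutually erasable patterns can be avoided without changing the image, so there are too few preimages for surjectivity; if it is not surjective, all images avoid a Garden of Eden pattern, so there are too few images for injectivity on the configurations supported in [F]. *)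

Local Open Scope nat_scope.

(** * Classical lists *)

Definition decb (P : Prop) : bool :=
  if excluded_middle_informative P then true else false.

Lemma decb_true (P : Prop) : decb P = true <-> P.
Proof. unfold decb; destruct (excluded_middle_informative P); intuition discriminate. Qed.

Lemma decb_false (P : Prop) : decb P = false <-> ~ P.
Proof. unfold decb; destruct (excluded_middle_informative P); intuition discriminate. Qed.

Lemma negb_decb (P : Prop) : negb (decb P) = true <-> ~ P.
Proof. rewrite Bool.negb_true_iff; apply decb_false. Qed.

Lemma eq_dec_classic (T : Type) (x y : T) : {x = y} + {x <> y}.
Proof. apply excluded_middle_informative. Qed.

Lemma finite_set_enum {T : Type} (P : T -> Prop) :
  finite_set P -> exists l, NoDup l /\ forall x, In x l <-> P x.
Proof.
  intros [l Hl].
  exists (nodup (@eq_dec_classic T) (filter (fun x => decb (P x)) l)); split.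
  - apply NoDup_nodup.
  - intro x. rewrite nodup_In, filter_In, decb_true. intuition.
Qed.

Lemma finite_set_sub {T : Type} (P P' : T -> Prop) :
  finite_set P' -> (forall x, P x -> P' x) -> finite_set P.
Proof. intros [l Hl] H; exists l; auto. Qed.

Lemma finite_set_or {T : Type} (P P' : T -> Prop) :
  finite_set P -> finite_set P' -> finite_set (fun x => P x \/ P' x).
Proof.
  intros [l Hl] [l' Hl']; exists (l ++ l'); intros x Hx.
  apply in_or_app; intuition.
Qed.

Lemma finite_set_bind {T U : Type} (P : T -> Prop) (S : T -> U -> Prop) :
  finite_set P -> (forall x, P x -> finite_set (S x)) ->
  finite_set (fun y => exists x, P x /\ S x y).
Proof.
  intros [l Hl] HS.
  assert (H : forall l', finite_set (fun y => exists x, In x l' /\ P x /\ S x y)).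
  { induction l' as [|a l' [L IH]].
    - exists nil. intros y (x & [] & _).
    - destruct (classic (P a)) as [Pa|Pa].
      + destruct (HS a Pa) as [La HLa]. exists (La ++ L).
        intros y (x & [->|Hx] & Px & Sx); apply in_or_app; [left|right; apply IH]; eauto.
      + exists L. intros y (x & [->|Hx] & Px & Sx); [tauto|eauto]. }
  apply finite_set_sub with (1 := H l). intros y (x & Px & Sx); eauto.
Qed.

(** * Inequalities between powers *)

(** These are the first two terms of the binomial expansion of [(a + 1) ^ (n + 1)]. *)
Lemma pow_succ_base_lower (a n : nat) : a ^ S n + S n * a ^ n <= S a ^ S n.
Proof.
  induction n as [|n IH]; [simpl; lia|].
  rewrite Nat.pow_succ_r', (Nat.pow_succ_r' (S a) (S n)).
  rewrite Nat.pow_succ_r' in *. nia.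
Qed.

(** Bernoulli's inequality for [(1 + 1/k) ^ k]: expansion by the factor [1 + 1/k], iterated [k]
    times, at least doubles. *)
Lemma pow_double (k : nat) : 2 * k ^ k <= S k ^ k \/ k = 0.
Proof.
  destruct k as [|m]; [now right|left].
  pose proof (pow_succ_base_lower (S m) m). simpl in *. lia.
Qed.

(** With [k = a * q + 1], the binomial bound gives [q * a ^ k < (a + 1) ^ k]: losing a factor
    [a / (a + 1)] at [k] places outweighs gaining one factor [q]. *)
Lemma pow_gap (a q r t : nat) :
  (a * q + 1) * r <= t -> 0 < t -> q ^ r * a ^ t < S a ^ t.
Proof.
  intros Hr Ht. set (k := a * q + 1) in *.
  assert (Hk : q * a ^ k < S a ^ k).
  { pose proof (pow_succ_base_lower a (a * q)) as H.
    assert (0 < a ^ (a * q)).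
    { destruct a; [simpl; lia|]. apply Nat.neq_0_lt_0, Nat.pow_nonzero; discriminate. }
    unfold k. rewrite Nat.add_1_r. rewrite Nat.pow_succ_r' in *. nia. }
  destruct (Nat.eq_dec r 0) as [->|Hr0].
  { rewrite Nat.pow_0_r, Nat.mul_1_l. apply Nat.pow_lt_mono_l; lia. }
  replace t with (k * r + (t - k * r)) by lia. set (s := t - k * r).
  rewrite !Nat.pow_add_r, !Nat.pow_mul_r, Nat.mul_assoc, <- Nat.pow_mul_l.
  assert (H1 : (q * a ^ k) ^ r < (S a ^ k) ^ r) by (apply Nat.pow_lt_mono_l; auto).
  assert (H2 : a ^ s <= S a ^ s) by (apply Nat.pow_le_mono_l; lia).
  assert (H3 : 0 < S a ^ s) by (apply Nat.neq_0_lt_0, Nat.pow_nonzero; discriminate).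
  nia.
Qed.

(** * Minimal solutions and Hall's theorem *)

(* By compactness, a chain of sets satisfying conditions that each look at finitely many points has a satisfactory intersection, so Zorn's lemma applies. *)
Lemma minimal_set {T J : Type} (phi : J -> (T -> Prop) -> Prop) (S0 : T -> Prop) :
  (forall j, exists l : list T, forall S S' : T -> Prop,
     (forall t, S t -> S0 t) -> (forall t, S' t -> S0 t) ->
     (forall t, In t l -> (S t <-> S' t)) -> phi j S -> phi j S') ->
  (forall j, phi j S0) ->
  exists S : T -> Prop, (forall t, S t -> S0 t) /\ (forall j, phi j S) /\
    (forall t, S t -> exists j, ~ phi j (fun t' => S t' /\ t' <> t)).
Proof.
  intros Hfin H0.
  (* Zorn's lemma yields maximal sets, so it is applied to the set of removed points. *)
  set (good := fun A : T -> Prop => forall j, phi j (fun t => S0 t /\ ~ A t)).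
  destruct (@classical_sets.Zorn_bigcup T good) as (A & HA & Hmax).
  - intros F HF Htot j.
    destruct (Hfin j) as [l Hl].
    (* A finite list meets the union of a chain within a single member; the empty set stands in when
       the chain has no member to offer. *)
    assert (HB : forall l' : list T, exists B, (F B \/ B = fun _ => False) /\
        forall t, In t l' -> classical_sets.bigcup F (fun X => X) t -> B t).
    { induction l' as [|a l' (B & HB & IH)].
      - exists (fun _ => False). split; [now right|intros t []].
      - destruct (classic (classical_sets.bigcup F (fun X => X) a)) as [[C FC Ca]|Ha].
        + destruct HB as [FB| ->].
          * destruct (Htot _ _ FB FC) as [S|S].
            -- exists C; split; [now left|]. intros t [<-|Ht] Hb; [exact Ca|].
               apply S. now apply IH.
            -- exists B; split; [now left|]. intros t [<-|Ht] Hb; [now apply S|].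
               now apply IH.
          * exists C; split; [now left|]. intros t [<-|Ht] Hb; [exact Ca|].
            destruct (IH t Ht Hb).
        + exists B; split; [exact HB|]. intros t [<-|Ht] Hb; [tauto|now apply IH]. }
    destruct (HB l) as (B & FB & HBl).
    apply (Hl (fun t => S0 t /\ ~ B t)); try tauto.
    + intros t Ht. split; intros [Ht0 Hn]; split; trivial; intro Hc; apply Hn.
      * now apply HBl.
      * destruct FB as [FB| ->]; [|destruct Hc]. exact (ex_intro2 _ _ B FB Hc).
    + destruct FB as [FB| ->].
      * apply (HF B FB).
      * apply (Hl S0); tauto || (intros; tauto) || auto.
  - exists (fun t => S0 t /\ ~ A t). split; [tauto|]. split; [exact HA|].
    intros t [Ht0 HtA].
    assert (Hn : ~ good (fun t' => A t' \/ t' = t)).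
    { apply Hmax. split.
      - intros x Hx; now left.
      - intro Hs. apply HtA. apply Hs. now right. }
    apply not_all_ex_not in Hn. destruct Hn as [j Hj]. exists j.
    intro Hp. apply Hj. destruct (Hfin j) as [l Hl].
    refine (Hl _ _ _ _ _ Hp); try tauto.
Qed.

(* Rado's argument: two elements of one set of a minimal family would give, by submodularity of [J |-> |union over J|], a violation of Hall's condition. *)
Lemma hall {I V : Type} (S0 : I -> V -> Prop) :
  (forall i, finite_set (S0 i)) ->
  (forall J L, NoDup J -> (forall i v, In i J -> S0 i v -> In v L) ->
     length J <= length L) ->
  exists f : I -> V, (forall i, S0 i (f i)) /\ (forall i j, f i = f j -> i = j).
Proof.
  intros Hfin Hhall.
  set (phi := fun (J : list I) (S : I * V -> Prop) => forall L, NoDup J ->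
     (forall i v, In i J -> S (i, v) -> In v L) -> length J <= length L).
  destruct (minimal_set phi (fun p => S0 (fst p) (snd p))) as (S & HS0 & HS & Hmin).
  - intro J.
    assert (HJ : finite_set (fun p : I * V => exists i, In i J /\ exists v, S0 i v /\ p = (i, v))).
    { apply finite_set_bind; [now exists J|]. intros i _.
      apply finite_set_bind; [apply Hfin|]. intros v _. exists ((i, v) :: nil).
      intros x ->; now left. }
    destruct HJ as [l Hl]. exists l. intros S S' HS HS' Hag Hp L HJ HL.
    apply Hp; auto. intros i v Hi Hv. apply (HL i v Hi). apply Hag; auto.
    apply Hl. exists i; split; auto. exists v; split; auto. apply (HS _ Hv).
  - intros J L HJ HL. apply Hhall; auto.
  - assert (Huniq : forall i x y, S (i, x) -> S (i, y) -> x = y).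
    { intros i x y Hx Hy. apply NNPP; intro Hxy.
      (* Deleting [(i, z)] breaks Hall's condition for some [J]; it held before, so [i] lies in
         [J]. *)
      assert (Hviol : forall z, S (i, z) -> exists J L, NoDup J /\ NoDup L /\ In i J /\
          length L < length J /\
          (forall k v, In k J -> S (k, v) -> (k, v) <> (i, z) -> In v L)).
      { intros z Hz. destruct (Hmin _ Hz) as [J HJ]. unfold phi in HJ.
        apply not_all_ex_not in HJ. destruct HJ as [L HJ].
        apply imply_to_and in HJ. destruct HJ as [HJ1 HJ].
        apply imply_to_and in HJ. destruct HJ as [HJ2 HJ].
        exists J, (nodup (@eq_dec_classic V) L).
        assert (Hlen : length (nodup (@eq_dec_classic V) L) <= length L).
        { apply NoDup_incl_length; [apply NoDup_nodup|]. intros a; now rewrite nodup_In. }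
        repeat split; auto; [apply NoDup_nodup| |lia|].
        - apply NNPP; intro HiJ. apply HJ. apply (HS J L HJ1).
          intros k v Hk Hv. apply (HJ2 k v Hk). split; auto.
          intros [= -> ->]; auto.
        - intros k v Hk Hv Hne. rewrite nodup_In. apply (HJ2 k v Hk); auto. }
      destruct (Hviol x Hx) as (J & A & NJ & NA & iJ & lJ & cJ).
      destruct (Hviol y Hy) as (K & B & NK & NB & iK & lK & cK).
      pose (mem := fun (U : Type) (l : list U) z => decb (In z l)).
      (* The union of [J] and [K] reaches only into the union of [A] and [B]: the pair [(i, x)] was
         deleted for [A] but survives for [B], since [x <> y]. *)
      assert (H1 : length (J ++ filter (fun k => negb (mem _ J k)) K)
                <= length (A ++ filter (fun k => negb (mem _ A k)) B)).
      { apply (HS (J ++ filter (fun k => negb (mem _ J k)) K)).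
        - apply NoDup_app; auto using NoDup_filter.
          intros a Ha Hb. apply filter_In in Hb. destruct Hb as [_ Hb].
          apply -> negb_decb in Hb. tauto.
        - assert (Hin : forall v, In v A \/ In v B -> In v (A ++ filter (fun k => negb (mem _ A k)) B)).
          { intros v Hv. apply in_or_app. destruct (classic (In v A)); [now left|].
            right. apply filter_In. split; [tauto|]. now apply <- negb_decb. }
          intros k v Hk Hv. apply Hin.
          assert (Hk' : In k J \/ In k K).
          { apply in_app_or in Hk. destruct Hk as [Hk|Hk]; auto.
            apply filter_In in Hk. tauto. }
          destruct (classic (k = i)) as [->|Hki].
          + destruct (classic (v = x)) as [->|Hvx].
            * right. apply (cK i); auto. congruence.
            * left. apply (cJ i); auto. congruence.
          + destruct Hk' as [Hk'|Hk'];
              [left; apply (cJ k)|right; apply (cK k)]; auto; congruence. }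
      (* Away from [i], the intersection of [J] and [K] reaches only into the intersection of [A]
         and [B]. *)
      assert (H2 : length (filter (mem _ J) K) <= 1 + length (filter (mem _ A) B)).
      { set (C := filter (fun k => decb (k <> i)) (filter (mem _ J) K)).
        assert (HC : forall k, In k C <-> In k K /\ In k J /\ k <> i).
        { intro k. unfold C, mem. rewrite !filter_In, !decb_true. tauto. }
        assert (H3 : length C <= length (filter (mem _ A) B)).
        { apply (HS C); [unfold C; auto using NoDup_filter|].
          intros k v Hk Hv. apply HC in Hk. destruct Hk as (HkK & HkJ & Hki).
          apply filter_In. split; [apply (cK k); auto; congruence|].
          apply <- decb_true. apply (cJ k); auto; congruence. }
        assert (H4 : length (filter (mem _ J) K) <= length (i :: C)).
        { apply NoDup_incl_length; [now apply NoDup_filter|].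
          intros a Ha. apply filter_In in Ha. destruct Ha as [HaK HaJ].
          apply -> decb_true in HaJ. destruct (classic (a = i)) as [Hai|Hai]; [now left|right].
          apply HC; auto. }
        simpl in H4. lia. }
      (* Adding up, [|J| + |K| <= |A| + |B| + 1], although [|A| < |J|] and [|B| < |K|]. *)
      rewrite !length_app in H1.
      pose proof (filter_length (mem _ J) K). pose proof (filter_length (mem _ A) B). lia. }
    assert (Hex : forall i, exists v, S (i, v)).
    { intro i. apply NNPP; intro Hn.
      assert (H : length (i :: nil) <= @length V nil).
      { apply (HS (i :: nil)); [repeat constructor; auto|].
        intros k v [<-|[]] Hv. destruct Hn; eauto. }
      simpl in H. lia. }
    exists (fun i => proj1_sig (constructive_indefinite_description _ (Hex i))).
    split.
    + intro i. destruct (constructive_indefinite_description _ (Hex i)) as [v Hv]; simpl.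
      apply (HS0 _ Hv).
    + intros i j.
      destruct (constructive_indefinite_description _ (Hex i)) as [v Hv]; simpl.
      destruct (constructive_indefinite_description _ (Hex j)) as [w Hw]; simpl.
      intros ->. apply NNPP; intro Hij.
      assert (H : length (i :: j :: nil) <= length (w :: nil)).
      { apply (HS (i :: j :: nil)).
        - constructor; [intros [?|[]]; auto|repeat constructor; auto].
        - intros k v [<-|[<-|[]]] Hk; left; [exact (Huniq _ _ _ Hv Hk)|exact (Huniq _ _ _ Hw Hk)]. }
      simpl in H. lia.
Qed.

(** * Locally finite invariant relations *)

Section Action.
Context {G : Group} {X : LHS G}.

Lemma act_Vl (g : G) (x : X) : act X (ginv G g) (act X g x) = x.
Proof. rewrite <- act_mul, gmul_Vl. apply act_one. Qed.

Lemma act_inj (g : G) (x y : X) : act X g x = act X g y -> x = y.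
Proof. intro H. now rewrite <- (act_Vl g x), H, act_Vl. Qed.

Lemma act_Vr (g : G) (x : X) : act X g (act X (ginv G g) x) = x.
Proof. apply (act_inj (ginv G g)). apply act_Vl. Qed.

Lemma gmul_Vr (x : G) : gmul G x (ginv G x) = gone G.
Proof.
  rewrite <- (gmul_1l G (gmul G x (ginv G x))).
  rewrite <- (gmul_Vl G (ginv G x)) at 1.
  rewrite gmul_assoc, <- (gmul_assoc G (ginv G x) x (ginv G x)).
  now rewrite gmul_Vl, gmul_1l, gmul_Vl.
Qed.

Lemma gmul_1r (x : G) : gmul G x (gone G) = x.
Proof. now rewrite <- (gmul_Vl G x), <- gmul_assoc, gmul_Vr, gmul_1l. Qed.

Lemma ginv_inv (g : G) : ginv G (ginv G g) = g.
Proof.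
  now rewrite <- (gmul_1r (ginv G (ginv G g))), <- (gmul_Vl G g), <- gmul_assoc,
    gmul_Vl, gmul_1l.
Qed.

Lemma rep_cos_of (K : coord X) (g : G) :
  act X (rep (cos_of K g)) (m0 K) = act X g (m0 K).
Proof.
  unfold rep. destruct (constructive_indefinite_description _ _) as [r Hr]; simpl in *.
  assert (H : exists g0, stab X (m0 K) g0 /\ r = gmul G g g0).
  { apply Hr. exists (gone G). split; [apply act_one|]. now rewrite gmul_1r. }
  destruct H as (g0 & Hg0 & ->). unfold stab in Hg0. now rewrite act_mul, Hg0.
Qed.

Definition lf_rel (R : X -> X -> Prop) : Prop :=
  (forall g x y, R x y -> R (act X g x) (act X g y)) /\ (forall x, finite_set (R x)).

Lemma lf_rel_intro (R : X -> X -> Prop) (m : X) :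
  (forall g x y, R x y -> R (act X g x) (act X g y)) -> finite_set (R m) -> lf_rel R.
Proof.
  intros HR [l Hl]; split; auto. intro x.
  destruct (lhs_transitive X m x) as [g <-].
  exists (map (act X g) l). intros y Hy. rewrite <- (act_Vr g y). apply in_map, Hl.
  rewrite <- (act_Vl g m). now apply HR.
Qed.

Lemma lf_rel_uniform (R : X -> X -> Prop) :
  lf_rel R -> exists D, forall x l, NoDup l -> (forall y, In y l -> R x y) -> length l <= D.
Proof.
  intros [HR Hfin]. destruct (lhs_nonempty X) as [m]. destruct (Hfin m) as [l0 Hl0].
  exists (length l0). intros x l Nl Hl.
  destruct (lhs_transitive X m x) as [g <-].
  rewrite <- (length_map (act X g) l0). apply NoDup_incl_length; auto.
  intros y Hy. rewrite <- (act_Vr g y). apply in_map, Hl0.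
  rewrite <- (act_Vl g m). apply HR. auto.
Qed.

Lemma lf_rel_or (R S : X -> X -> Prop) :
  lf_rel R -> lf_rel S -> lf_rel (fun x y => R x y \/ S x y).
Proof.
  intros [HR FR] [HS FS]; split.
  - intros g x y [H|H]; auto.
  - intro x; now apply finite_set_or.
Qed.

Lemma lf_rel_eq : lf_rel (fun x y => x = y).
Proof. split; [congruence|]. intro x; exists (x :: nil); intros y ->; now left. Qed.

Lemma lf_rel_comp (R S : X -> X -> Prop) :
  lf_rel R -> lf_rel S -> lf_rel (fun x z => exists y, R x y /\ S y z).
Proof.
  intros [HR FR] [HS FS]; split.
  - intros g x z (y & H & H'); eauto.
  - intro x; now apply finite_set_bind.
Qed.

(** If [R x m] and [x] is [h] applied to [m], then [s], the image of [m] under the inverse of [h],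
    lies in the finite section of [m]. The elements carrying [s] to [m] form a coset of the
    stabiliser of [s], so finitely many [h], hence finitely many [x], remain. *)
Lemma lf_rel_converse (R : X -> X -> Prop) :
  finite_stabilisers X -> lf_rel R -> lf_rel (fun x y => R y x).
Proof.
  intros Hst [HR FR]. destruct (lhs_nonempty X) as [m].
  apply (lf_rel_intro _ m); [auto|].
  assert (H : finite_set (fun x => exists s, R m s /\ exists h, act X h s = m /\ x = act X h m)).
  { apply finite_set_bind; auto. intros s _.
    destruct (lhs_transitive X s m) as [hs Hhs]. destruct (Hst s) as [l Hl].
    exists (map (fun k => act X (gmul G hs k) m) l). intros x (h & Hh & ->).
    apply in_map_iff. exists (gmul G (ginv G hs) h). split.
    - now rewrite !act_mul, act_Vr.
    - apply Hl. unfold stab. now rewrite act_mul, Hh, <- Hhs, act_Vl. }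
  apply finite_set_sub with (1 := H). intros x Hx.
  destruct (lhs_transitive X m x) as [h Hh]. exists (act X (ginv G h) m).
  split; [|exists h; split; [apply act_Vr|auto]].
  rewrite <- (act_Vl h m) at 1. rewrite Hh. now apply HR.
Qed.

Fixpoint iter_rel (R : X -> X -> Prop) (n : nat) : X -> X -> Prop :=
  match n with
  | 0 => fun x y => x = y
  | S n => fun x z => exists y, iter_rel R n x y /\ R y z
  end.

Lemma lf_rel_iter (R : X -> X -> Prop) (n : nat) : lf_rel R -> lf_rel (iter_rel R n).
Proof.
  intro HR. induction n as [|n IH]; [apply lf_rel_eq|]. now apply lf_rel_comp.
Qed.

Definition neighbours (R : X -> X -> Prop) (F : list X) (y : X) : Prop :=
  exists x, In x F /\ R x y.

Lemma neighbours_finite (R : X -> X -> Prop) (F : list X) :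
  lf_rel R -> finite_set (neighbours R F).
Proof.
  intros [_ FR]. apply finite_set_bind; [now exists F|auto].
Qed.

Lemma neighbours_enum (R : X -> X -> Prop) (F : list X) :
  lf_rel R -> exists L, NoDup L /\ forall y, In y L <-> neighbours R F y.
Proof. intro HR. now apply finite_set_enum, neighbours_finite. Qed.

(** * Foelner sets *)

(** An injection moving points along [R] is piecewise a right semi-action by finitely many cosets,
    hence its image has measure 1. Two disjoint such images would have total measure 2. *)
Lemma right_amenable_no_doubling (R : X -> X -> Prop) (f : X * bool -> X) :
  right_amenable X -> lf_rel R -> (forall x b, R x (f (x, b))) ->
  (forall p q, f p = f q -> p = q) -> False.
Proof.
  intros (K & mu & mu_ge0 & mu_T & mu_U & mu_inv) [HR FR] Hf finj.
  assert (mu_ext : forall A B : X -> Prop, (forall x, A x <-> B x) -> mu A = mu B).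
  { intros A B H. f_equal. apply functional_extensionality. intro x.
    now apply propositional_extensionality. }
  assert (mu_0 : forall A : X -> Prop, (forall x, ~ A x) -> mu A = 0%R).
  { intros A HA. assert (H := mu_U A A (fun x a _ => HA x a)).
    rewrite (mu_ext (fun x => A x \/ A x) A) in H; [lra|tauto]. }
  assert (mu_img : forall h : X -> X, (forall x, R x (h x)) ->
            (forall x y, h x = h y -> x = y) ->
            mu (fun y => exists x, True /\ y = h x) = 1%R).
  { intros h Hh hinj.
    (* Induction on the list [S] of displacements [s], measured in the coordinates [gsel K a]. *)
    assert (H : forall (S : list X) (A : X -> Prop),
       (forall a, A a -> exists s, In s S /\ h a = act X (gsel K a) s) ->
       mu (fun y => exists a, A a /\ y = h a) = mu A).
    { induction S as [|s S IH]; intros A HA.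
      - rewrite !mu_0; auto.
        + intros x Ax. now destruct (HA x Ax) as (s & [] & _).
        + intros x (a & Aa & _). now destruct (HA a Aa) as (s & [] & _).
      - pose (A1 := fun a => A a /\ h a = act X (gsel K a) s).
        pose (A2 := fun a => A a /\ h a <> act X (gsel K a) s).
        rewrite (mu_ext A (fun a => A1 a \/ A2 a)); [|unfold A1, A2; intro; tauto].
        rewrite mu_U; [|unfold A1, A2; intro; tauto].
        rewrite (mu_ext _ (fun y => (exists a, A1 a /\ y = h a) \/ (exists a, A2 a /\ y = h a))).
        2:{ intro y; split.
            - intros (a & Aa & ->).
              destruct (classic (h a = act X (gsel K a) s)); [left|right]; exists a; unfold A1, A2; auto.
            - intros [(a & [Aa _] & ->)|(a & [Aa _] & ->)]; eauto. }
        rewrite mu_U.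
        2:{ intros y (a & [_ Ha] & ->) (b & [_ Hb] & E). apply hinj in E. now subst. }
        f_equal.
        + assert (Hs : forall a, rsemi a (cos_of K (gsel K s)) = act X (gsel K a) s).
          { intro a. unfold rsemi.
            now rewrite act_mul, rep_cos_of, gsel_spec. }
          rewrite <- (mu_inv (cos_of K (gsel K s)) A1).
          * apply mu_ext. intro y. split; intros (a & [Aa Ha] & ->); exists a;
              (split; [split; auto|]); rewrite Hs; congruence.
          * intros a b [_ Ha] [_ Hb]. rewrite !Hs. rewrite <- Ha, <- Hb. apply hinj.
        + apply IH. intros a [Aa Ha]. destruct (HA a Aa) as (t & [->|Ht] & E); [tauto|eauto]. }
    (* By invariance of [R], the displacements of [h] all lie in the finite section of [m0 K]. *)
    destruct (FR (m0 K)) as [l Hl]. rewrite (H l); [exact mu_T|].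
    intros a _. exists (act X (ginv G (gsel K a)) (h a)). split; [|now rewrite act_Vr].
    apply Hl. rewrite <- (act_Vl (gsel K a) (m0 K)), gsel_spec. now apply HR. }
  assert (inj_b : forall b, forall x y, f (x, b) = f (y, b) -> x = y)
    by (intros b x y E; apply finj in E; congruence).
  assert (I1 := mu_img (fun x => f (x, true)) (fun x => Hf x true) (inj_b true)).
  assert (I2 := mu_img (fun x => f (x, false)) (fun x => Hf x false) (inj_b false)).
  cbv beta in I1, I2.
  assert (U := mu_U (fun y => exists x, True /\ y = f (x, true))
                    (fun y => exists x, True /\ y = f (x, false))).
  rewrite I1, I2 in U.
  set (W := fun y => (exists x, True /\ y = f (x, true)) \/ (exists x, True /\ y = f (x, false))) in *.
  assert (HW := mu_U W (fun y => ~ W y) (fun x a b => b a)).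
  cbv beta in HW.
  rewrite (mu_ext (fun x => W x \/ ~ W x) (fun _ => True)) in HW.
  2:{ intro y; split; auto. intros _; apply classic. }
  assert (mu W = (1 + 1)%R).
  { apply U. intros y (a & _ & ->) (b & _ & E). apply finj in E. discriminate. }
  specialize (mu_ge0 (fun y => ~ W y)). lra.
Qed.

(** If there were no such set, [R] would expand every finite set by the factor [1 + 1/k], and its
    [k]-th iterate by at least 2, which is Hall's condition for two copies of [X]. *)
Lemma folner (R : X -> X -> Prop) (k : nat) :
  right_amenable X -> lf_rel R ->
  exists F L, NoDup F /\ F <> nil /\ NoDup L /\ (forall y, In y L <-> neighbours R F y) /\
    k * length L <= S k * length F.
Proof.
  intros Ham HR. destruct k as [|k].
  { destruct (lhs_nonempty X) as [m]. destruct (neighbours_enum R (m :: nil) HR) as (L & NL & HL).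
    exists (m :: nil), L. repeat split; auto; [repeat constructor; auto|discriminate|apply HL|apply HL|].
    simpl; lia. }
  apply NNPP; intro Hno. set (K := S k) in *.
  assert (Hexp : forall F L, NoDup F -> (forall y, neighbours R F y -> In y L) ->
             S K * length F <= K * length L).
  { intros F L NF HL. destruct F as [|x F]; [simpl; lia|].
    destruct (neighbours_enum R (x :: F) HR) as (L' & NL' & HL').
    apply NNPP; intro Hlt. apply Hno. exists (x :: F), L'.
    repeat split; auto; [discriminate|apply HL'|apply HL'|].
    assert (length L' <= length L).
    { apply NoDup_incl_length; auto. intros y Hy. apply HL. now apply HL'. }
    nia. }
  assert (Hiter : forall n F L, NoDup F -> (forall y, neighbours (iter_rel R n) F y -> In y L) ->
             S K ^ n * length F <= K ^ n * length L).
  { induction n as [|n IH]; intros F L NF HL.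
    - simpl. rewrite !Nat.add_0_r. apply NoDup_incl_length; auto.
      intros x Hx. apply HL. exists x; simpl; auto.
    - destruct (neighbours_enum (iter_rel R n) F (lf_rel_iter R n HR)) as (L' & NL' & HL').
      assert (H1 : S K ^ n * length F <= K ^ n * length L') by (apply IH; auto; intro; apply HL').
      assert (H2 : S K * length L' <= K * length L).
      { apply Hexp; auto. intros z (y & Hy & Hz). apply HL' in Hy. destruct Hy as (x & Hx & Hxy).
        apply HL. exists x; split; auto. exists y; auto. }
      apply (Nat.mul_le_mono_l _ _ (S K)) in H1. apply (Nat.mul_le_mono_l _ _ (K ^ n)) in H2.
      rewrite !Nat.pow_succ_r'. nia. }
  assert (RK := lf_rel_iter R K HR).
  destruct (hall (fun p : X * bool => iter_rel R K (fst p))) as (f & Hf & finj).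
  - intros [x b]. apply RK.
  - intros J L NJ HL.
    set (F := nodup (@eq_dec_classic X) (map fst J)).
    assert (HF : forall x, In x F <-> exists b, In (x, b) J).
    { intro x. unfold F. rewrite nodup_In, in_map_iff. split.
      - intros ([y b] & <- & H). eauto.
      - intros [b Hb]. exists (x, b); auto. }
    assert (H1 : length J <= length (list_prod F (true :: false :: nil))).
    { apply NoDup_incl_length; auto. intros [x b] Hx. apply in_prod.
      - apply HF; eauto.
      - destruct b; simpl; auto. }
    rewrite length_prod in H1. simpl in H1.
    assert (H2 : S K ^ K * length F <= K ^ K * length L).
    { apply Hiter; [apply NoDup_nodup|]. intros y (x & Hx & Hxy).
      apply HF in Hx. destruct Hx as [b Hb]. now apply (HL (x, b)). }
    destruct (pow_double K) as [H3|H3]; [|discriminate].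
    assert (H4 : 0 < K ^ K) by (apply Nat.neq_0_lt_0, Nat.pow_nonzero; discriminate).
    nia.
  - apply (right_amenable_no_doubling (iter_rel R K) f Ham RK); auto.
    intros x b. apply (Hf (x, b)).
Qed.

End Action.

(** * Counting patterns *)

Section Covers.
Context {T Q : Type}.

(** Counting without a type of patterns: the length of [L], which may contain repetitions or
    functions outside [S], bounds the number of restrictions to [Y] of members of [S]. *)
Definition covers (S : (T -> Q) -> Prop) (Y : list T) (L : list (T -> Q)) : Prop :=
  forall e, S e -> exists l, In l L /\ forall y, In y Y -> e y = l y.

Definition glue (Y : list T) (l1 l2 : T -> Q) (y : T) : Q :=
  if decb (In y Y) then l1 y else l2 y.

Lemma glue_in (Y : list T) (l1 l2 : T -> Q) (y : T) : In y Y -> glue Y l1 l2 y = l1 y.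
Proof. intro H. unfold glue. now rewrite (proj2 (decb_true _) H). Qed.

Lemma glue_out (Y : list T) (l1 l2 : T -> Q) (y : T) : ~ In y Y -> glue Y l1 l2 y = l2 y.
Proof. intro H. unfold glue. now rewrite (proj2 (decb_false _) H). Qed.

Lemma covers_glue (S : (T -> Q) -> Prop) (Y1 Y2 : list T) (L1 L2 : list (T -> Q)) :
  covers S Y1 L1 -> covers S Y2 L2 ->
  exists L, length L = length L1 * length L2 /\ covers S (Y1 ++ Y2) L.
Proof.
  intros H1 H2.
  exists (map (fun p => glue Y1 (fst p) (snd p)) (list_prod L1 L2)).
  split; [now rewrite length_map, length_prod|].
  intros e He. destruct (H1 e He) as (l1 & I1 & E1). destruct (H2 e He) as (l2 & I2 & E2).
  exists (glue Y1 l1 l2). split.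
  - apply in_map_iff. exists (l1, l2). split; auto. now apply in_prod.
  - intros y Hy. destruct (classic (In y Y1)) as [Hi|Hi].
    + rewrite glue_in; auto.
    + rewrite glue_out; auto. apply E2. apply in_app_or in Hy. tauto.
Qed.

Lemma covers_sub (S S' : (T -> Q) -> Prop) (Y Y' : list T) (L : list (T -> Q)) :
  covers S' Y' L -> (forall e, S e -> S' e) -> (forall y, In y Y -> In y Y') -> covers S Y L.
Proof. intros H HS HY e He. destruct (H e (HS e He)) as (l & Hl & E). eauto. Qed.

Context (ql : list Q) (ql_full : forall a, In a ql) (ql_nodup : NoDup ql) (e0 : T -> Q).

Lemma covers_all (Y : list T) :
  exists L, length L = length ql ^ length Y /\ covers (fun _ => True) Y L.
Proof.
  induction Y as [|y Y (L & HL & HC)].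
  - exists (e0 :: nil). split; auto. intros e _. exists e0. split; [now left|intros y []].
  - assert (H1 : covers (fun _ => True) (y :: nil) (map (fun a _ => a) ql)).
    { intros e _. exists (fun _ => e y). split; [|intros z [<-|[]]; auto].
      apply in_map_iff. exists (e y); auto. }
    destruct (covers_glue _ _ _ _ _ H1 HC) as (L' & HL' & HC').
    exists L'. split; auto. rewrite HL', HL, length_map. simpl. ring.
Qed.

(** Some function in a full list agrees with [u] on [P], and the filter discards it. *)
Lemma covers_avoiding (P : list T) (u : T -> Q) :
  exists L, length L < length ql ^ length P /\
    covers (fun e => exists p, In p P /\ e p <> u p) P L.
Proof.
  destruct (covers_all P) as (L & HL & HC).
  set (f := fun l : T -> Q => decb (exists p, In p P /\ l p <> u p)).
  exists (filter f L). split.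
  - rewrite <- HL, <- (filter_length f L).
    destruct (HC u I) as (l & Hl & E).
    assert (Hin : In l (filter (fun x => negb (f x)) L)).
    { apply filter_In. split; auto. unfold f. apply <- negb_decb.
      intros (p & Hp & Hn). apply Hn. symmetry; auto. }
    destruct (filter (fun x => negb (f x)) L); [destruct Hin|simpl; lia].
  - intros e (p & Hp & Hn). destruct (HC e I) as (l & Hl & E).
    exists l. split; auto. apply filter_In. split; auto. unfold f. apply <- decb_true.
    exists p. split; auto. now rewrite <- E.
Qed.

Lemma fibres_length {U : Type} (g : U -> Q) (n : nat) (qs : list Q) :
  NoDup qs -> forall L, (forall a, In a qs -> n <= length (filter (fun l => decb (g l = a)) L)) ->
  length qs * n <= length L.
Proof.
  induction 1 as [|a qs Ha Hqs IH]; intros L HL; [simpl; lia|].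
  rewrite <- (filter_length (fun l => decb (g l = a)) L). simpl.
  apply Nat.add_le_mono; [apply HL; now left|].
  apply IH. intros b Hb. replace (filter _ (filter _ L)) with (filter (fun l => decb (g l = b)) L).
  { apply HL; now right. }
  assert (Hab : a <> b) by congruence.
  clear - Hab. induction L as [|l L IH]; auto. simpl.
  destruct (classic (g l = a)) as [H|H].
  - rewrite (proj2 (decb_true _) H). simpl. rewrite IH.
    now rewrite (proj2 (decb_false (g l = b))) by congruence.
  - rewrite (proj2 (decb_false _) H). simpl. now rewrite IH.
Qed.

(** For each value [a], the listed functions with value [a] at [x] still cover the remaining points,
    and these fibres are disjoint. *)
Lemma covers_all_lower (F : list T) :
  NoDup F -> forall L, covers (fun _ => True) F L -> length ql ^ length F <= length L.
Proof.
  induction 1 as [|x F Hx HF IH]; intros L HL.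
  - destruct (HL e0 I) as (l & Hl & _). destruct L; [destruct Hl|simpl; lia].
  - simpl. apply (fibres_length (fun l : T -> Q => l x)); auto.
    intros a _. apply IH. intros e _.
    destruct (HL (glue F e (fun _ => a)) I) as (l & Hl & E). exists l. split.
    + apply filter_In. split; auto. apply <- decb_true.
      rewrite <- E by now left. now apply glue_out.
    + intros y Hy. rewrite <- E by now right. now rewrite glue_in.
Qed.

End Covers.

(** * Separated subsets of a finite set *)

(** Keep the first point [x], discard the at most [D] points related to it, and recurse. Separation
    is recorded in list order, as the greedy choice produces it. *)
Lemma greedy_separated {T : Type} (C : T -> T -> Prop) (D : nat) :
  (forall x, C x x) ->
  (forall x l, NoDup l -> (forall y, In y l -> C x y) -> length l <= D) ->
  forall F, NoDup F -> exists U, (forall x, In x U -> In x F) /\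
    ForallOrdPairs (fun x y => ~ C x y) U /\ length F <= D * length U.
Proof.
  intros Crefl HD F. assert (Hn : exists n, length F <= n) by eauto.
  destruct Hn as [n Hn]. revert F Hn. induction n as [|n IH]; intros F Hn NF.
  - exists nil. split; [intros x []|split; [apply FOP_nil|destruct F; simpl in *; lia]].
  - destruct F as [|x F]; [exists nil; split; [intros x []|split; [apply FOP_nil|simpl; lia]]|].
    set (f := fun y => decb (C x y)).
    pose proof (filter_length f (x :: F)) as Hlen.
    set (A := filter f (x :: F)) in *. set (B := filter (fun y => negb (f y)) (x :: F)) in *.
    assert (HA : length A <= D).
    { apply (HD x); [now apply NoDup_filter|]. intros y Hy. apply filter_In in Hy.
      now apply -> decb_true. }
    assert (HA0 : 0 < length A).
    { assert (HxA : In x A) by (apply filter_In; split; [now left|now apply <- decb_true]).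
      destruct A; [destruct HxA|simpl; lia]. }
    destruct (IH B) as (U & HUB & HU & HBU); [simpl in *; lia|now apply NoDup_filter|].
    assert (HB : forall y, In y U -> In y (x :: F) /\ ~ C x y).
    { intros y Hy. apply HUB, filter_In in Hy. destruct Hy as [Hy Hny]. split; auto.
      now apply -> negb_decb. }
    exists (x :: U). split; [|split].
    + intros y [<-|Hy]; [now left|]. now apply HB.
    + apply FOP_cons; auto. apply Forall_forall. intros y Hy. now apply HB.
    + simpl length in *. nia.
Qed.

(** * Patterns avoiding a given pattern at disjoint translates *)

Section Key.
Context {G : Group} {X : LHS G} {Q : Type}.
Context (ql : list Q) (ql_full : forall a, In a ql) (ql_nodup : NoDup ql).

Definition disjoint_translates (P : list X) (g h : G) : Prop :=
  forall p p', In p P -> In p' P -> act X g p <> act X h p'.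

Definition avoids (P : list X) (u : X -> Q) (gs : list G) (e : X -> Q) : Prop :=
  forall g, In g gs -> exists p, In p P /\ e (act X g p) <> u p.

(** Each disjoint translate multiplies the count by at most [a / (a + 1)], where [a + 1] is the
    number of patterns on [P]; the bound is written without division. *)
Lemma covers_avoids (P : list X) (u : X -> Q) (a : nat) (gs : list G) :
  NoDup P -> S a = length ql ^ length P ->
  ForallOrdPairs (disjoint_translates P) gs ->
  forall Y, NoDup Y -> (forall g p, In g gs -> In p P -> In (act X g p) Y) ->
  exists L, length L * S a ^ length gs <= a ^ length gs * length ql ^ length Y /\
    covers (avoids P u gs) Y L.
Proof.
  intros NP Ha. assert (Hq : length ql <> 0).
  { destruct (lhs_nonempty X) as [m]. pose proof (ql_full (u m)) as H. intros E%length_zero_iff_nil. now rewrite E in H. }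
  induction 1 as [|g gs Hg Hgs IH]; intros Y NY HY.
  - destruct (covers_all ql ql_full u Y) as (L & HL & HC). exists L. split.
    + simpl. lia.
    + apply (covers_sub _ _ _ _ _ HC); auto.
  - set (gP := map (act X g) P).
    (* Split [Y] into the translate [gP] and the rest, which still contains all other translates by
       disjointness. *)
    set (Y' := filter (fun y => negb (decb (In y gP))) Y).
    assert (HlY : length Y' + length P <= length Y).
    { rewrite <- (filter_length (fun y => decb (In y gP)) Y). fold Y'.
      assert (length P <= length (filter (fun y => decb (In y gP)) Y)); [|lia].
      rewrite <- (length_map (act X g) P). apply NoDup_incl_length.
      - apply NoDup_map_NoDup_ForallPairs; auto. intros x y _ _. apply act_inj.
      - intros y Hy. apply filter_In. split; [|now apply <- decb_true].
        apply in_map_iff in Hy. destruct Hy as (p & <- & Hp). apply HY; auto. now left. }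
    destruct (IH Y') as (L2 & HL2 & HC2).
    + now apply NoDup_filter.
    + intros h p Hh Hp. apply filter_In. split; [apply HY; auto; now right|].
      apply <- negb_decb. intro H. apply in_map_iff in H. destruct H as (p' & E & Hp').
      rewrite Forall_forall in Hg. now apply (Hg h Hh p' p).
    + destruct (covers_avoiding ql ql_full u gP (fun y => u (act X (ginv G g) y)))
        as (L1 & HL1 & HC1).
      unfold gP in HL1. rewrite length_map, <- Ha in HL1.
      assert (HC1' : covers (avoids P u (g :: gs)) gP L1).
      { apply (covers_sub _ _ _ _ _ HC1); auto. intros e He.
        destruct (He g) as (p & Hp & Hn); [now left|]. exists (act X g p).
        split; [now apply in_map|]. now rewrite act_Vl. }
      assert (HC2' : covers (avoids P u (g :: gs)) Y' L2).
      { apply (covers_sub _ _ _ _ _ HC2); auto. intros e He h Hh. apply He. now right. }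
      destruct (covers_glue _ _ _ _ _ HC1' HC2') as (L & HL & HC).
      exists L. split.
      * assert (H1 : length ql ^ length Y' * S a <= length ql ^ length Y).
        { rewrite Ha, <- Nat.pow_add_r. now apply Nat.pow_le_mono_r. }
        assert (H2 : length L1 <= a) by lia.
        rewrite HL. simpl length. rewrite !Nat.pow_succ_r'.
        apply Nat.le_trans with (length L1 * (length L2 * S a ^ length gs) * S a); [lia|].
        apply Nat.le_trans with (a * (a ^ length gs * length ql ^ length Y') * S a).
        { apply Nat.mul_le_mono_r, Nat.mul_le_mono; auto. }
        apply Nat.le_trans with (a * a ^ length gs * (length ql ^ length Y' * S a)); [lia|].
        now apply Nat.mul_le_mono_l.
      * apply (covers_sub _ _ _ _ _ HC); auto. intros y Hy. apply in_or_app.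
        destruct (classic (In y gP)); auto. right. apply filter_In. split; auto.
        now apply <- negb_decb.
Qed.

(* On a Foelner set, the factor lost at each of the many disjoint translates outweighs the factor gained at the few boundary points. *)
Lemma few_avoiding_patterns (R : X -> X -> Prop) (P : list X) (u : X -> Q) :
  right_amenable X -> finite_stabilisers X -> lf_rel R -> NoDup P ->
  exists F gs, NoDup F /\ ForallOrdPairs (disjoint_translates P) gs /\
    exists L, length L < length ql ^ length F /\
      forall e, avoids P u gs e ->
        exists l, In l L /\ forall y, neighbours R F y -> e y = l y.
Proof.
  intros Ham Hst HR NP. destruct (lhs_nonempty X) as [m].
  assert (Hq : 0 < length ql).
  { pose proof (ql_full (u m)) as H. apply Nat.neq_0_lt_0.
    intros E%length_zero_iff_nil. now rewrite E in H. }
  set (sel := fun x => proj1_sig (constructive_indefinite_description _ (lhs_transitive X m x))).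
  assert (Hsel : forall x, act X (sel x) m = x).
  { intro x. unfold sel. now destruct (constructive_indefinite_description _ _). }
  set (B := fun x z => exists g, act X g m = x /\ exists p, In p P /\ z = act X g p).
  assert (HB : lf_rel B).
  { apply (lf_rel_intro B m).
    - intros g x y (h & Hh & p & Hp & ->). exists (gmul G g h). rewrite act_mul, Hh.
      split; auto. exists p. split; auto. now rewrite act_mul.
    - apply finite_set_bind; [apply Hst|]. intros g _.
      apply finite_set_bind; [now exists P|]. intros p _. exists (act X g p :: nil).
      intros y ->; now left. }
  (* Points unrelated by [C] carry disjoint translates of [P]; the diagonal is there for the greedy
     choice. *)
  set (C := fun x y => x = y \/ exists z, B x z /\ B y z).
  assert (HC : lf_rel C).
  { apply lf_rel_or; [apply lf_rel_eq|].
    apply (lf_rel_comp B (fun z y => B y z)); auto. now apply lf_rel_converse. }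
  destruct (lf_rel_uniform C HC) as [D HD].
  assert (Hpow : exists a, S a = length ql ^ length P).
  { exists (length ql ^ length P - 1).
    assert (0 < length ql ^ length P) by (apply Nat.neq_0_lt_0, Nat.pow_nonzero; lia). lia. }
  destruct Hpow as [a Ha].
  set (k := a * length ql + 1).
  (* Equality puts [F] inside [Y], [R] puts the sites to be covered there, and [B] the translates of
     [P]. *)
  set (R' := fun x y => x = y \/ (R x y \/ B x y)).
  assert (HR' : lf_rel R') by (apply lf_rel_or; [apply lf_rel_eq|now apply lf_rel_or]).
  (* With [r] points of [Y] beyond [F] and [t] translates, the constant [D * k] gives
     [D * k * r <= |F| <= D * t], so [k] translates pay for each boundary point. *)
  destruct (folner R' (D * k) Ham HR') as (F & Y & NF & F0 & NY & HY & Hlen).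
  destruct (greedy_separated C D) with (F := F) as (U & HUF & HU & HFU); auto.
  { intro x; now left. }
  exists F, (map sel U).
  assert (Hdisj : ForallOrdPairs (disjoint_translates P) (map sel U)).
  { clear - HU Hsel. induction HU as [|x U Hx HU IH]; simpl; constructor; auto.
    apply Forall_forall. intros h Hh. apply in_map_iff in Hh. destruct Hh as (y & <- & Hy).
    rewrite Forall_forall in Hx. intros p p' Hp Hp' E. apply (Hx y Hy). right.
    exists (act X (sel x) p). split; [exists (sel x)|exists (sel y)]; split; eauto. }
  split; [auto|split; [auto|]].
  destruct (covers_avoids P u a (map sel U) NP Ha Hdisj Y NY) as (L & HL & HCov).
  { intros g p Hg Hp. apply in_map_iff in Hg. destruct Hg as (x & <- & Hx).
    apply HY. exists x. split; auto. right; right. exists (sel x). split; eauto. }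
  exists L. split.
  - rewrite length_map in HL.
    assert (HFY : length F <= length Y).
    { apply NoDup_incl_length; auto. intros x Hx. apply HY. exists x. split; auto. now left. }
    assert (HF0 : 0 < length F) by (destruct F; [congruence|simpl; lia]).
    set (r := length Y - length F). set (t := length U) in *.
    assert (Ht : 0 < t) by (destruct t; lia).
    assert (HD0 : 0 < D) by (destruct D; lia).
    assert (Hr : k * r <= t).
    { apply (Nat.mul_le_mono_pos_l _ _ D); auto.
      assert (D * k * length Y = D * k * length F + D * k * r)
        by (rewrite <- Nat.mul_add_distr_l; f_equal; unfold r; lia).
      simpl in Hlen. lia. }
    assert (Hgap := pow_gap a (length ql) r t Hr Ht).
    replace (length Y) with (length F + r) in HL by (unfold r; lia).
    rewrite Nat.pow_add_r in HL.
    assert (HqF : 0 < length ql ^ length F) by (apply Nat.neq_0_lt_0, Nat.pow_nonzero; lia).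
    apply (Nat.mul_lt_mono_pos_r (S a ^ t)); [lia|].
    apply Nat.le_lt_trans with (1 := HL).
    replace (a ^ t * (length ql ^ length F * length ql ^ r))
      with (length ql ^ length F * (length ql ^ r * a ^ t)) by ring.
    now apply Nat.mul_lt_mono_pos_l.
  - intros e He. destruct (HCov e He) as (l & Hl & E). exists l. split; auto.
    intros y (x & Hx & Hxy). apply E, HY. exists x. split; auto. right; now left.
Qed.
End Key.

(** * Local equivariant maps *)

Section Moore_Myhill.
Context {G : Group} {X : LHS G} {Q : Type}.
Context (ql : list Q) (ql_full : forall a, In a ql) (ql_nodup : NoDup ql).
Context (N : X -> X -> Prop) (N_lf : lf_rel N).
Context (D : (X -> Q) -> (X -> Q)).
Context (D_local : forall c c' m, (forall y, N m y -> c y = c' y) -> D c m = D c' m).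
Context (D_equivariant : forall g c m, D (fun y => c (act X g y)) m = D c (act X g m)).
Context (X_amenable : right_amenable X) (X_stab : finite_stabilisers X).

(* [P] contains every site that shares a neighbourhood with a difference, so swapping an occurrence of [c] on [P] for [c'] is invisible to [D]. *)
Lemma swap_invisible (c c' e : X -> Q) (P : list X) :
  D c = D c' ->
  (forall y, c y <> c' y -> In y P) ->
  (forall m d y, c d <> c' d -> N m d -> N m y -> In y P) ->
  (forall p, In p P -> e p = c p) ->
  D (glue P c' e) = D e.
Proof.
  intros Hc Hdiff HP He. apply functional_extensionality. intro m.
  destruct (classic (exists d, N m d /\ c d <> c' d)) as [(d & Hd & Hn)|Hno].
  - rewrite (D_local e c), Hc.
    + apply D_local. intros y Hy. apply glue_in. eauto.
    + intros y Hy. apply He. eauto.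
  - apply D_local. intros y Hy. destruct (classic (In y P)) as [Hi|Hi].
    + rewrite glue_in, He; auto. apply NNPP. intro H. apply Hno. exists y. auto.
    + now apply glue_out.
Qed.

(** Translates are treated one at a time: where [c] still occurs, it is replaced by [c'], and
    disjointness preserves what was achieved at the translates already treated. *)
Lemma erase_occurrences (c c' : X -> Q) (P : list X) :
  D c = D c' -> c <> c' ->
  (forall y, c y <> c' y -> In y P) ->
  (forall m d y, c d <> c' d -> N m d -> N m y -> In y P) ->
  forall gs, ForallOrdPairs (disjoint_translates P) gs ->
  forall e, exists e', avoids P c gs e' /\ D e' = D e.
Proof.
  intros Hc Hne Hdiff HP. induction 1 as [|g gs Hg Hgs IH]; intro e.
  - exists e. split; auto. intros g [].
  - destruct (IH e) as (e1 & Ha & HD).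
    destruct (classic (exists p, In p P /\ e1 (act X g p) <> c p)) as [Hp|Hno].
    + exists e1. split; auto. intros h [<-|Hh]; auto.
    + set (e2 := glue P c' (fun y => e1 (act X g y))).
      exists (fun y => e2 (act X (ginv G g) y)). split.
      * intros h [<-|Hh].
        -- assert (Hd : exists d, c d <> c' d).
           { apply NNPP. intro H. apply Hne. apply functional_extensionality. intro y.
             apply NNPP. intro Hy. apply H. eauto. }
           destruct Hd as [d Hd]. exists d. split; auto.
           rewrite act_Vl. unfold e2. rewrite glue_in; auto.
        -- destruct (Ha h Hh) as (p & Hp & Hn). exists p. split; auto.
           unfold e2. rewrite glue_out; [now rewrite act_Vr|].
           intro Hi. rewrite Forall_forall in Hg.
           apply (Hg h Hh _ p Hi Hp). now rewrite act_Vr.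
      * rewrite <- HD. apply functional_extensionality. intro m.
        rewrite D_equivariant. unfold e2. rewrite (swap_invisible c); auto.
        -- now rewrite D_equivariant, act_Vr.
        -- intros p Hp. apply NNPP. intro H. apply Hno. eauto.
Qed.

(** Moore's half. If [c] and [c'] violate pre-injectivity, every configuration has a preimage
    avoiding [c] at all the translates, so the images of fewer than [|Q| ^ |F|] functions would
    exhaust the patterns on [F]. *)
Lemma surjective_pre_injective : surjective_map D -> pre_injective D.
Proof.
  intros Hsurj c c' Hfin Hc. apply NNPP. intro Hne.
  destruct N_lf as [N_inv N_fin].
  (* The differences together with every site sharing a neighbourhood with one of them; finiteness
     uses the converse of [N]. *)
  assert (HP : finite_set (fun y => c y <> c' y \/
      exists d, c d <> c' d /\ exists m, N m d /\ N m y)).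
  { apply finite_set_or; auto. apply finite_set_bind; auto. intros d _.
    apply finite_set_bind; auto. apply (lf_rel_converse N X_stab N_lf). }
  destruct (finite_set_enum _ HP) as (P & NP & HPP).
  destruct (few_avoiding_patterns ql ql_full N P c X_amenable X_stab N_lf NP)
    as (F & gs & NF & Hgs & L & HL & Hcov).
  apply (Nat.lt_irrefl (length L)). apply Nat.lt_le_trans with (1 := HL).
  rewrite <- (length_map D L). apply (covers_all_lower ql ql_nodup c); auto.
  intros u _. destruct (Hsurj u) as [e <-].
  destruct (erase_occurrences c c' P Hc Hne) with (gs := gs) (e := e) as (e' & He' & <-); auto.
  - intros y Hy. apply HPP. now left.
  - intros m d y Hd Hmd Hmy. apply HPP. right. eauto.
  - destruct (Hcov e' He') as (l & Hl & E). exists (D l). split; [now apply in_map|].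
    intros x Hx. apply D_local. intros y Hy. apply E. exists x; auto.
Qed.

(** The image of [D] is closed, by compactness: a minimal set [S] of allowed pairs that still
    permits every finite solution is the graph of a partial function, which yields a solution. *)
Lemma finitely_realised_in_image (u : X -> Q) :
  (forall P : list X, exists e, forall x, In x P -> D e x = u x) -> exists e, D e = u.
Proof.
  intro Hu. destruct N_lf as [N_inv N_fin].
  set (phi := fun (P : list X) (S : X * Q -> Prop) =>
     exists e, (forall y, neighbours N P y -> S (y, e y)) /\ forall x, In x P -> D e x = u x).
  destruct (minimal_set phi (fun _ => True)) as (S & _ & HS & Hmin).
  - intro P. destruct (neighbours_enum N P N_lf) as (Y & _ & HY).
    exists (list_prod Y ql). intros S S' _ _ Hag (e & He & HD). exists e. split; auto.
    intros y Hy. apply Hag; [|auto]. apply in_prod; auto. now apply HY.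
  - intro P. destruct (Hu P) as [e He]. exists e. auto.
  - assert (Huniq : forall y a b, S (y, a) -> S (y, b) -> a = b).
    { intros y a b Ha Hb. apply NNPP. intro Hab.
      (* A solution for [P1 ++ P2] misses [a] or [b] at [y], so it survives one of the two
         deletions. *)
      destruct (Hmin _ Ha) as [P1 H1]. destruct (Hmin _ Hb) as [P2 H2].
      destruct (HS (P1 ++ P2)) as (e & He & HD).
      destruct (classic (e y = a)) as [Hea|Hea]; [apply H2|apply H1]; exists e;
        (split; [intros z (x & Hx & Hz); split; [|congruence]|intros x Hx];
         [apply He; exists x; split; auto|apply HD]; apply in_or_app; auto). }
    (* The default is taken only at points in no neighbourhood, which [D] ignores. *)
    exists (fun y => match excluded_middle_informative (exists v, S (y, v)) with
                     | left H => proj1_sig (constructive_indefinite_description _ H)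
                     | right _ => u y
                     end).
    apply functional_extensionality. intro x.
    destruct (HS (x :: nil)) as (e & He & HD). rewrite <- HD by now left.
    apply D_local. intros y Hy.
    assert (HSy : S (y, e y)) by (apply He; exists x; split; [now left|auto]).
    destruct (excluded_middle_informative _) as [H|H]; [|destruct H; eauto].
    destruct (constructive_indefinite_description _ H) as [v Hv]; simpl. eauto.
Qed.

(** Myhill's half. A [u] outside the image has a finite Garden of Eden pattern, avoided by all
    images at every translate. By pre-injectivity, a configuration equal to [u] off [F] is
    determined by its image near [F], which leaves too few of them. *)
Lemma pre_injective_surjective : pre_injective D -> surjective_map D.
Proof.
  intros Hinj u. apply NNPP. intro Hno.
  assert (HP : exists P, NoDup P /\ ~ exists e, forall x, In x P -> D e x = u x).
  { apply NNPP. intro H. apply Hno. apply finitely_realised_in_image. intro P.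
    apply NNPP. intro HP. apply H. exists (nodup (@eq_dec_classic X) P).
    split; [apply NoDup_nodup|]. intros [e He]. apply HP. exists e. intros x Hx.
    apply He. now apply nodup_In. }
  destruct HP as (P & NP & HP).
  (* The sections of the converse over [F] are the sites whose neighbourhood meets [F], the only
     ones where changes in [F] show. *)
  set (N' := fun x y => N y x).
  assert (HN' : lf_rel N') by now apply lf_rel_converse.
  destruct (few_avoiding_patterns ql ql_full N' P u X_amenable X_stab HN' NP)
    as (F & gs & NF & Hgs & L & HL & Hcov).
  assert (Hav : forall e, avoids P u gs (D e)).
  { intros e g _. apply NNPP. intro H. apply HP. exists (fun y => e (act X g y)).
    intros x Hx. rewrite D_equivariant. apply NNPP. intro Hn. apply H. eauto. }
  set (supported := fun e : X -> Q => forall y, ~ In y F -> e y = u y).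
  set (fits := fun (l e : X -> Q) => supported e /\ forall y, neighbours N' F y -> D e y = l y).
  set (pick := fun l => match excluded_middle_informative (exists e, fits l e) with
                        | left H => proj1_sig (constructive_indefinite_description _ H)
                        | right _ => u
                        end).
  apply (Nat.lt_irrefl (length L)). apply Nat.lt_le_trans with (1 := HL).
  rewrite <- (length_map pick L). apply (covers_all_lower ql ql_nodup u); auto.
  intros e _. set (e1 := glue F e u).
  assert (Hs1 : supported e1) by (intros y Hy; now apply glue_out).
  destruct (Hcov (D e1) (Hav e1)) as (l & Hl & E).
  exists (pick l). split; [now apply in_map|].
  assert (Hpick : fits l (pick l)).
  { unfold pick. destruct (excluded_middle_informative _) as [H|H].
    - now destruct (constructive_indefinite_description _ H).
    - destruct H. exists e1. split; auto. }
  destruct Hpick as [Hs2 E2].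
  assert (Heq : e1 = pick l).
  { apply Hinj.
    - exists F. intros y Hy. apply NNPP. intro Hn. apply Hy. now rewrite Hs1, Hs2.
    - apply functional_extensionality. intro y.
      destruct (classic (neighbours N' F y)) as [Hy|Hy].
      + now rewrite E, E2.
      + apply D_local. intros z Hz.
        assert (~ In z F) by (intro Hi; apply Hy; exists z; auto).
        now rewrite Hs1, Hs2. }
  intros x Hx. rewrite <- Heq. unfold e1. now rewrite glue_in.
Qed.

End Moore_Myhill.

(** * Cellular automata as local equivariant maps *)

Section Automaton.
Context {G : Group} {X : LHS G} (K : coord X).

Definition neighbourhood_rel (N : coset K -> Prop) (m y : X) : Prop :=
  exists n, N n /\ y = rsemi m n.

(** The semi-action commutes with [G] only up to this element, which compares the coordinates at [m]
    and at its translate. It lies in the stabiliser of [m0 K], so the invariance of the local rule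
    absorbs it. *)
Definition transfer (g : G) (m : X) : G :=
  gmul G (ginv G (gsel K (act X g m))) (gmul G g (gsel K m)).

Lemma transfer_stab (g : G) (m : X) : stab X (m0 K) (transfer g m).
Proof.
  unfold stab, transfer. rewrite !act_mul, gsel_spec.
  apply (act_inj (gsel K (act X g m))). now rewrite act_Vr, gsel_spec.
Qed.

Lemma act_rsemi (g : G) (m : X) (n : coset K) :
  act X g (rsemi m n) = rsemi (act X g m) (cact (transfer g m) n).
Proof.
  unfold rsemi, cact. rewrite (act_mul X (gsel K (act X g m))), rep_cos_of.
  unfold transfer. now rewrite !act_mul, act_Vr.
Qed.

Lemma neighbourhood_rel_lf (Q : Type) (N : coset K -> Prop) (delta : (coset K -> Q) -> Q) :
  finite_set N -> is_CA N delta -> lf_rel (neighbourhood_rel N).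
Proof.
  intros [l Hl] (_ & Hstab & _). split.
  - intros g m y (n & Hn & ->). exists (cact (transfer g m) n).
    split; [apply Hstab; auto; apply transfer_stab|apply act_rsemi].
  - intro m. exists (map (rsemi m) l). intros y (n & Hn & ->). apply in_map; auto.
Qed.

Lemma global_equivariant (Q : Type) (N : coset K -> Prop) (delta : (coset K -> Q) -> Q)
    (g : G) (c : X -> Q) (m : X) :
  is_CA N delta ->
  global delta (fun y => c (act X g y)) m = global delta c (act X g m).
Proof.
  intros (_ & _ & Hinv). unfold global.
  assert (Hs : stab X (m0 K) (ginv G (transfer g m))).
  { unfold stab. rewrite <- (transfer_stab g m) at 1. apply act_Vl. }
  symmetry. rewrite <- (Hinv _ Hs). f_equal. apply functional_extensionality. intro n.
  now rewrite ginv_inv, act_rsemi.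
Qed.

End Automaton.

(** The coordinate system witnessing amenability may differ from [K]; the two meet only through
    invariant relations, whose definition mentions neither. *)
Theorem mainTheorem1 :
  forall (G : Group) (X : LHS G),
    right_amenable X ->
    finite_stabilisers X ->
    forall (Q : Type) (K : coord X) (N : coset K -> Prop)
           (delta : (coset K -> Q) -> Q),
      finite_type Q ->
      finite_set N ->
      is_CA N delta ->
      (surjective_map (global delta) <-> pre_injective (global delta)).
Proof.
  intros G X Ham Hst Q K N delta [l Hl] HN HCA.
  set (ql := nodup (@eq_dec_classic Q) l).
  assert (Hfull : forall a, In a ql) by (intro a; apply nodup_In; apply Hl).
  assert (Hnodup : NoDup ql) by apply NoDup_nodup.
  assert (Hlf := neighbourhood_rel_lf K Q N delta HN HCA).
  assert (Hloc : forall (c c' : X -> Q) m, (forall y, neighbourhood_rel K N m y -> c y = c' y) ->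
            global delta c m = global delta c' m).
  { intros c c' m H. apply HCA. intros n Hn. apply H. exists n; auto. }
  assert (Heqv := fun g c m => global_equivariant K Q N delta g c m HCA).
  split.
  - apply (surjective_pre_injective ql Hfull Hnodup _ Hlf _ Hloc Heqv Ham Hst).
  - apply (pre_injective_surjective ql Hfull Hnodup _ Hlf _ Hloc Heqv Ham Hst).
Qed.
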